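(* Let $n\ge 2$ and $\theta(z)=z^n$. Then $\mathcal{K}_\theta=\operatorname{span}\{1,z,\ldots,z^{n-1}\}$. With respect to the basis $e_j=z^j$, $0\le j\le n-1$, an operator $T=(T_{ij})_{i,j=0}^{n-1}$ on $\mathcal{K}_\theta$ belongs to $\mathcal{S}_\theta=\mathcal{T}_\theta+\mathcal{H}_\theta$ if and only if $$T_{i-1,j}+T_{i+1,j}=T_{i,j-1}+T_{i,j+1},\qquad 1\le i,j\le n-2.$$ Equivalently, $T\in\mathcal{S}_\theta$ if and only if $(T_{ij})$ is a Toeplitz-plus-Hankel matrix, i.e. the sum of an $n\times n$ Toeplitz matrix and an $n\times n$ Hankel matrix.
   Context: $\mathbb{T}$ is the unit circle with normalized Lebesgue measure, $L^2=L^2(\mathbb{T})$, $H^2\subset L^2$ is the Hardy space (functions with vanishing negative Fourier coefficients), $H^2_-=L^2\ominus H^2$, and $P_{H^2_-}$ is the orthogonal projection onto $H^2_-$. For an inner function $\theta$, the model space is $\mathcal{K}_\theta=H^2\ominus\theta H^2$ and $P_{\mathcal{K}_\theta}:L^2\to\mathcal{K}_\theta$ is the orthogonal projection. For $\varphi\in L^\infty(\mathbb{T})$ the truncated Toeplitz operator is $A_\varphi f=P_{\mathcal{K}_\theta}(\varphi f)$, $f\in\mathcal{K}_\theta$, and the truncated Hankel operator is $B_\varphi f=P_{\mathcal{K}_\theta}JP_{H^2_-}(\varphi f)$, $f\in\mathcal{K}_\theta$, where $J:L^2\to L^2$ is the unitary $(Jf)(z)=\bar z f(\bar z)$. $\mathcal{T}_\theta$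 and $\mathcal{H}_\theta$ are the spaces of all truncated Toeplitz and all truncated Hankel operators on $\mathcal{K}_\theta$, and $\mathcal{S}_\theta=\mathcal{T}_\theta+\mathcal{H}_\theta$. Matrix entries are $T_{ij}=\langle Te_j,e_i\rangle$. A matrix $(M_{ij})_{i,j=0}^{n-1}$ is Toeplitz if $M_{ij}$ depends only on $i-j$, and Hankel if $M_{ij}$ depends only on $i+j$. *)

(* Defs.v *)
From mathcomp Require Import all_boot all_order all_algebra.
From mathcomp Require Import all_classical all_reals all_analysis.
From mathcomp Require Import complex.

Set Implicit Arguments.
Unset Strict Implicit.
Unset Printing Implicit Defensive.

Import Order.TTheory GRing.Theory Num.Theory.
Import numFieldNormedType.Exports.

Local Open Scope classical_set_scope.
Local Open Scope ring_scope.
Local Open Scope complex_scope.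

(* Functions on the unit circle are represented by functions [R[i] -> R[i]],
   of which only the values on the circle matter: every notion below looks at
   [f] through the parametrization [t |-> exp(2 pi i t)], [0 <= t <= 1], which
   carries Lebesgue measure on [0, 1] to normalized Lebesgue measure.
   Elements of L^2 are such functions, and equality in L^2 is [eqT]. *)

Definition circle_pt {R : realType} (t : R) : R[i] :=
  cos (2 * pi * t) +i* sin (2 * pi * t).

Definition circle_measurable {R : realType} (f : R[i] -> R[i]) : Prop :=
  measurable_fun `[(0 : R), 1] (fun t : R => complex.Re (f (circle_pt t))) /\
  measurable_fun `[(0 : R), 1] (fun t : R => complex.Im (f (circle_pt t))).

Definition circle_ae {R : realType} (P : R[i] -> Prop) : Prop :=
  {ae @lebesgue_measure R, forall t : R, 0 <= t <= 1 -> P (circle_pt t)}.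

Definition eqT {R : realType} (f g : R[i] -> R[i]) : Prop :=
  circle_ae (fun z => f z = g z).

Definition circle_int {R : realType} (f : R[i] -> R[i]) : R[i] :=
  Rintegral (@lebesgue_measure R) `[(0 : R), 1] (fun t => complex.Re (f (circle_pt t))) +i*
  Rintegral (@lebesgue_measure R) `[(0 : R), 1] (fun t => complex.Im (f (circle_pt t))).

Definition cmod {R : realType} (z : R[i]) : R := ComplexField.Normc.normc z.

Definition L2 {R : realType} : set (R[i] -> R[i]) :=
  [set f | circle_measurable f /\
    (@lebesgue_measure R).-integrable `[(0 : R), 1]
      (fun t => (cmod (f (circle_pt t)) ^+ 2)%:E)].

Definition Linfty {R : realType} : set (R[i] -> R[i]) :=
  [set f | circle_measurable f /\
    exists M : R, circle_ae (fun z => cmod (f z) <= M)].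

Definition dotL2 {R : realType} (f g : R[i] -> R[i]) : R[i] :=
  circle_int (fun z => f z * conjc (g z)).

Definition fourier {R : realType} (f : R[i] -> R[i]) (k : int) : R[i] :=
  dotL2 f (fun z => z ^ k).

Definition H2 {R : realType} : set (R[i] -> R[i]) :=
  [set f | L2 f /\ forall k : int, k < 0 -> fourier f k = 0].

Definition inner_function {R : realType} (theta : R[i] -> R[i]) : Prop :=
  H2 theta /\ circle_ae (fun z => cmod (theta z) = 1).

Definition ominus {R : realType} (M N : set (R[i] -> R[i])) :
    set (R[i] -> R[i]) :=
  [set f | M f /\ forall g, N g -> dotL2 f g = 0].

Definition H2minus {R : realType} : set (R[i] -> R[i]) := ominus L2 H2.

Definition model_space {R : realType} (theta : R[i] -> R[i]) :
    set (R[i] -> R[i]) :=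
  ominus H2 [set (fun z => theta z * h z) | h in H2].

(* [is_proj M f g]: the orthogonal projection of [f] onto [M] is [g];
   [g] is determined only up to [eqT]. *)
Definition is_proj {R : realType} (M : set (R[i] -> R[i]))
    (f g : R[i] -> R[i]) : Prop :=
  M g /\ forall h, M h -> dotL2 (fun z => f z - g z) h = 0.

Definition flipJ {R : realType} (f : R[i] -> R[i]) : R[i] -> R[i] :=
  fun z => conjc z * f (conjc z).

(* Linear operators on a subspace [M] of L^2. Boundedness is not required:
   it is automatic when [M] has finite dimension, and for the truncated
   operators below it follows from the boundedness of the symbol. *)
Definition is_operator {R : realType} (M : set (R[i] -> R[i]))
    (T : (R[i] -> R[i]) -> (R[i] -> R[i])) : Prop :=
  [/\ forall f, M f -> M (T f),
      forall f g, M f -> M g -> eqT f g -> eqT (T f) (T g) &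
      forall (a : R[i]) f g, M f -> M g ->
        eqT (T (fun z => a * f z + g z)) (fun z => a * T f z + T g z)].

Definition truncated_Toeplitz {R : realType} (theta : R[i] -> R[i]) :
    set ((R[i] -> R[i]) -> (R[i] -> R[i])) :=
  [set A | exists2 phi, Linfty phi & forall f, model_space theta f ->
    is_proj (model_space theta) (fun z => phi z * f z) (A f)].

Definition truncated_Hankel {R : realType} (theta : R[i] -> R[i]) :
    set ((R[i] -> R[i]) -> (R[i] -> R[i])) :=
  [set B | exists2 phi, Linfty phi & forall f, model_space theta f ->
    exists2 g, is_proj H2minus (fun z => phi z * f z) g &
      is_proj (model_space theta) (flipJ g) (B f)].

Definition Toeplitz_plus_Hankel_op {R : realType} (theta : R[i] -> R[i]) :
    set ((R[i] -> R[i]) -> (R[i] -> R[i])) :=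
  [set T | exists A B, [/\ truncated_Toeplitz theta A,
    truncated_Hankel theta B &
    forall f, model_space theta f -> eqT (T f) (fun z => A f z + B f z)]].

Definition monomial {R : realType} (j : nat) : R[i] -> R[i] :=
  fun z => z ^+ j.

Definition L2span {R : realType} (n : nat) (e : nat -> R[i] -> R[i]) :
    set (R[i] -> R[i]) :=
  [set f | L2 f /\ exists c : 'I_n -> R[i],
    eqT f (fun z => \sum_(j < n) c j * e j z)].

Definition L2free {R : realType} (n : nat) (e : nat -> R[i] -> R[i]) : Prop :=
  forall c : 'I_n -> R[i],
    eqT (fun z => \sum_(j < n) c j * e j z) (fun=> 0) -> forall j, c j = 0.

Definition entry {R : realType} (T : (R[i] -> R[i]) -> (R[i] -> R[i]))
    (i j : nat) : R[i] :=
  dotL2 (T (monomial j)) (monomial i).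

Definition op_matrix {R : realType} (n : nat)
    (T : (R[i] -> R[i]) -> (R[i] -> R[i])) : 'M[R[i]]_n :=
  \matrix_(i < n, j < n) entry T i j.

Definition Toeplitz_mx {K : Type} (n : nat) (M : 'M[K]_n) : Prop :=
  forall i j k l : 'I_n,
    (i : nat)%:Z - (j : nat)%:Z = (k : nat)%:Z - (l : nat)%:Z ->
    M i j = M k l.

Definition Hankel_mx {K : Type} (n : nat) (M : 'M[K]_n) : Prop :=
  forall i j k l : 'I_n, (i + j = k + l)%N -> M i j = M k l.

(* Main.v *)
Require Import Defs.
From HB Require Import structures.
From mathcomp Require Import all_boot all_order all_algebra.
From mathcomp Require Import all_classical all_reals all_analysis.
From mathcomp Require Import measurable_realfun.
From mathcomp Require Import complex ring lra zify.

Import Order.TTheory GRing.Theory Num.Theory.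
Import numFieldNormedType.Exports.
Local Open Scope classical_set_scope.
Local Open Scope ring_scope.

(** A function in the model space of [z ^ n] has spectrum in [0, n): it lies in [H2],
    and being orthogonal to [z ^ n * z ^ m] kills the coefficients from [n] on. The
    finite Fourier sum then accounts for all its coefficients, so it is that sum almost
    everywhere, provided that an [L2] function without Fourier coefficients vanishes.

    That uniqueness ([L2_fourier_uniqueness]) is the analytic core. For [x] in (0, 1)
    the trigonometric polynomial [sin (pi t) * sin (pi (x - t))] is positive for [t < x]
    and negative for [t > x]. Iterating the cubic [(3 y - y^3) / 2] on it gives
    trigonometric polynomials that stay bounded by 1 and converge to its sign. If [u] is
    integrable and orthogonal to all trigonometric polynomials, dominated convergence
    shows that the integral of [u] over [0, x] equals its integral over [x, 1]; their
    sum is 0 too, so both vanish, and Lebesgue differentiation gives [u = 0].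

    The entries of an operator in the sum space are read off the symbols: with [phi] for
    the Toeplitz part and [psi] for the Hankel part, entry [(i, j)] is the coefficient of
    [phi] at [i - j] plus that of [psi] at [- 1 - i - j]
    ([Toeplitz_plus_Hankel_op_entries]). Conversely any array [a (i - j) + b (i + j)]
    comes from two trigonometric polynomials used as symbols
    ([entries_Toeplitz_plus_Hankel_op]).

    What remains is discrete: an array [M] satisfies the wave equation exactly when it is
    Toeplitz plus Hankel. The equation says that [M (i + 1) j - M i (j + 1)] is constant
    along diagonals; subtracting a Toeplitz array with the same differences leaves an
    array constant along antidiagonals ([wave_Toeplitz_plus_Hankel]). *)

Set Implicit Arguments.
Unset Strict Implicit.
Unset Printing Implicit Defensive.

(** * Real and imaginary parts *)

Section ComplexParts.
Context {R : realType}.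
Implicit Types x y z : R[i].

Lemma complex_ReD x y : complex.Re (x + y) = complex.Re x + complex.Re y.
Proof. by case: x y => [? ?] [? ?]. Qed.

Lemma complex_ImD x y : complex.Im (x + y) = complex.Im x + complex.Im y.
Proof. by case: x y => [? ?] [? ?]. Qed.

Lemma complex_ReM x y : complex.Re (x * y) =
  complex.Re x * complex.Re y - complex.Im x * complex.Im y.
Proof. by case: x y => [? ?] [? ?]. Qed.

Lemma complex_ImM x y : complex.Im (x * y) =
  complex.Re x * complex.Im y + complex.Im x * complex.Re y.
Proof. by case: x y => [? ?] [? ?]. Qed.

Lemma complex_ReJ x : complex.Re (conjc x) = complex.Re x.
Proof. by case: x. Qed.

Lemma complex_ImJ x : complex.Im (conjc x) = - complex.Im x.
Proof. by case: x. Qed.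

Lemma conjcM x y : conjc (x * y) = conjc x * conjc y.
Proof. exact: rmorphM. Qed.

Lemma eq_complex_parts x y : complex.Re x = complex.Re y ->
  complex.Im x = complex.Im y -> x = y.
Proof. by case: x y => [? ?] [? ?] /= -> ->. Qed.

Lemma cmod_sqr z : cmod z ^+ 2 = complex.Re z ^+ 2 + complex.Im z ^+ 2.
Proof.
by case: z => a b; rewrite /cmod /= sqr_sqrtr// addr_ge0// sqr_ge0.
Qed.

End ComplexParts.

(** * Measurability and integration on the circle *)

Lemma measurable_unit_itv {R : realType} : measurable `[(0 : R), 1]%classic.
Proof. exact: measurable_itv. Qed.
#[local] Hint Resolve measurable_unit_itv : core.

Section Circle.
Context {R : realType}.
Local Notation mu := (@lebesgue_measure R).
Local Notation I01 := (`[(0 : R), 1]%classic).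
Local Notation C := R[i].
Implicit Types f g h : C -> C.

Lemma norm_circle_pt (t : R) : `|circle_pt t| = 1.
Proof. by rewrite normc_def /= cos2Dsin2 sqrtr1. Qed.

Lemma circle_pt_neq0 (t : R) : circle_pt t != 0.
Proof. by rewrite -normr_eq0 norm_circle_pt oner_eq0. Qed.

Lemma conj_circle_pt (t : R) : conjc (circle_pt t) = (circle_pt t)^-1.
Proof. by rewrite invc_norm norm_circle_pt expr1n invr1 mul1r. Qed.

Lemma conjc_expz (z : C) (k : int) : conjc (z ^ k) = conjc z ^ k.
Proof. by case: k => k; rewrite ?conjc_inv; [|congr _^-1]; exact: rmorphXn. Qed.

Lemma conj_circle_ptX (t : R) (k : int) :
  conjc (circle_pt t ^ k) = circle_pt t ^ (- k).
Proof. by rewrite conjc_expz conj_circle_pt exprz_inv. Qed.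

Lemma circle_pt_flip (t : R) : circle_pt (1 - t) = conjc (circle_pt t).
Proof.
have e : 2 * pi * (1 - t) = - (2 * pi * t) + pi *+ 2 :> R by ring.
by rewrite /circle_pt e cosD2pi sinD2pi cosN sinN.
Qed.

Lemma continuous_circle_Re : continuous (fun t : R => cos (2 * pi * t)).
Proof.
move=> t; apply: continuous_comp; last exact: continuous_cos.
by apply: cvgM; [exact: cvg_cst|exact: cvg_id].
Qed.

Lemma continuous_circle_Im : continuous (fun t : R => sin (2 * pi * t)).
Proof.
move=> t; apply: continuous_comp; last exact: continuous_sin.
by apply: cvgM; [exact: cvg_cst|exact: cvg_id].
Qed.

Lemma circle_measurable_cst (c : C) : circle_measurable (fun=> c).
Proof. by split; exact: measurable_cst. Qed.

Lemma circle_measurable_id : circle_measurable (fun z : C => z).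
Proof.
split; apply: measurable_funTS; apply: continuous_measurable_fun.
- exact: continuous_circle_Re.
- exact: continuous_circle_Im.
Qed.

Lemma circle_measurableD f g : circle_measurable f -> circle_measurable g ->
  circle_measurable (fun z => f z + g z).
Proof.
move=> [f1 f2] [g1 g2]; split => /=.
- under [X in measurable_fun _ X]eq_fun do rewrite complex_ReD; exact: measurable_funD.
- under [X in measurable_fun _ X]eq_fun do rewrite complex_ImD; exact: measurable_funD.
Qed.

Lemma circle_measurableM f g : circle_measurable f -> circle_measurable g ->
  circle_measurable (fun z => f z * g z).
Proof.
move=> [f1 f2] [g1 g2]; split => /=.
- under [X in measurable_fun _ X]eq_fun do rewrite complex_ReM.
  by apply: measurable_funB; exact: measurable_funM.
- under [X in measurable_fun _ X]eq_fun do rewrite complex_ImM.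
  by apply: measurable_funD; exact: measurable_funM.
Qed.

Lemma circle_measurableJ f : circle_measurable f ->
  circle_measurable (fun z => conjc (f z)).
Proof.
move=> [f1 f2]; split => /=.
- by under [X in measurable_fun _ X]eq_fun do rewrite complex_ReJ.
- by under [X in measurable_fun _ X]eq_fun do rewrite complex_ImJ; exact: measurableT_comp.
Qed.

Lemma eq_circle_measurable f g : (forall t, f (circle_pt t) = g (circle_pt t)) ->
  circle_measurable f -> circle_measurable g.
Proof.
move=> fg [f1 f2]; split.
- by under [X in measurable_fun _ X]eq_fun do rewrite -fg.
- by under [X in measurable_fun _ X]eq_fun do rewrite -fg.
Qed.

Lemma circle_measurableX (k : nat) : circle_measurable (fun z : C => z ^+ k).
Proof.
elim: k => [|k IH]; first exact: circle_measurable_cst.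
under eq_fun do rewrite exprS.
exact: circle_measurableM circle_measurable_id IH.
Qed.

Lemma circle_measurable_expz (k : int) : circle_measurable (fun z : C => z ^ k).
Proof.
case: k => k; first exact: circle_measurableX.
apply: (@eq_circle_measurable (fun z => conjc (z ^+ k.+1))).
  move=> t; rewrite [in RHS]NegzE -conj_circle_ptX//.
exact/circle_measurableJ/circle_measurableX.
Qed.

Definition circle_integrable f : Prop :=
  mu.-integrable I01 (EFin \o (fun t => complex.Re (f (circle_pt t)))) /\
  mu.-integrable I01 (EFin \o (fun t => complex.Im (f (circle_pt t)))).

Lemma integrable_dominated (u v : R -> R) : measurable_fun I01 u ->
  mu.-integrable I01 (EFin \o v) -> (forall t, I01 t -> `|u t| <= v t) ->
  mu.-integrable I01 (EFin \o u).
Proof.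
move=> mu_ vi uv; apply: le_integrable vi => //; first exact/measurable_EFinP.
move=> t It /=; rewrite lee_fin (le_trans (uv t It))//; exact: ler_norm.
Qed.

Lemma integrable_funD (u v : R -> R) : mu.-integrable I01 (EFin \o u) ->
  mu.-integrable I01 (EFin \o v) ->
  mu.-integrable I01 (EFin \o (fun t => u t + v t)).
Proof. by move=> ui vi; exact: (integrableD _ ui vi). Qed.

Lemma integrable_funZ (c : R) (u : R -> R) : mu.-integrable I01 (EFin \o u) ->
  mu.-integrable I01 (EFin \o (fun t => c * u t)).
Proof. by move=> ui; exact: (integrableZl _ c ui). Qed.

Lemma integrable_unit_itv_cst (c : R) : mu.-integrable I01 (EFin \o (fun=> c)).
Proof.
apply: continuous_compact_integrable; first exact: segment_compact.
by apply: continuous_subspaceT => t; exact: cvg_cst.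
Qed.

Lemma circle_intD f g : circle_integrable f -> circle_integrable g ->
  circle_int (fun z => f z + g z) = circle_int f + circle_int g.
Proof.
move=> [f1 f2] [g1 g2]; apply: eq_complex_parts; rewrite ?complex_ReD ?complex_ImD /=.
- by rewrite -RintegralD//; apply: eq_Rintegral => t _; rewrite complex_ReD.
- by rewrite -RintegralD//; apply: eq_Rintegral => t _; rewrite complex_ImD.
Qed.

Lemma circle_intZ (c : C) f : circle_integrable f ->
  circle_int (fun z => c * f z) = c * circle_int f.
Proof.
move=> [f1 f2]; apply: eq_complex_parts; rewrite ?complex_ReM ?complex_ImM /=.
- rewrite -!RintegralZl// -RintegralB//; try exact: integrable_funZ.
  by apply: eq_Rintegral => t _; rewrite complex_ReM.
- rewrite -!RintegralZl// -RintegralD//; try exact: integrable_funZ.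
  by apply: eq_Rintegral => t _; rewrite complex_ImM.
Qed.

Lemma circle_intJ f : circle_integrable f ->
  circle_int (fun z => conjc (f z)) = conjc (circle_int f).
Proof.
move=> [f1 f2]; apply: eq_complex_parts; rewrite ?complex_ReJ ?complex_ImJ /=.
- by apply: eq_Rintegral => t _; rewrite complex_ReJ.
- rewrite -mulN1r -RintegralZl//.
  by apply: eq_Rintegral => t _; rewrite complex_ImJ mulN1r.
Qed.

Lemma eq_circle_int f g : (forall t, f (circle_pt t) = g (circle_pt t)) ->
  circle_int f = circle_int g.
Proof.
by move=> fg; congr Complex; apply: eq_Rintegral => t _; rewrite fg.
Qed.

Lemma ae_imply (P Q : R -> Prop) : (forall t, P t -> Q t) ->
  {ae mu, forall t, P t} -> {ae mu, forall t, Q t}.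
Proof. by move=> PQ; apply: filterS; first exact: (ae_filter_ringOfSetsType mu). Qed.

Lemma ae_imply2 (P Q S : R -> Prop) : (forall t, P t -> Q t -> S t) ->
  {ae mu, forall t, P t} -> {ae mu, forall t, Q t} -> {ae mu, forall t, S t}.
Proof. by move=> PQS; apply: filterS2; first exact: (ae_filter_ringOfSetsType mu). Qed.

Lemma circle_ae_mono (P Q : C -> Prop) :
  (forall t, P (circle_pt t) -> Q (circle_pt t)) -> circle_ae P -> circle_ae Q.
Proof.
move=> PQ; rewrite /circle_ae; apply: ae_imply => t Pt It; exact/PQ/Pt.
Qed.

Lemma circle_ae_mono2 (P Q S : C -> Prop) :
  (forall t, P (circle_pt t) -> Q (circle_pt t) -> S (circle_pt t)) ->
  circle_ae P -> circle_ae Q -> circle_ae S.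
Proof.
move=> PQS; rewrite /circle_ae; apply: ae_imply2 => t Pt Qt It.
by apply: PQS; [exact: Pt|exact: Qt].
Qed.

Lemma circle_ae_all (P : C -> Prop) : (forall t, P (circle_pt t)) -> circle_ae P.
Proof. by move=> Pt; apply: aeW => t _. Qed.

Lemma eqT_trans f g h : eqT f g -> eqT g h -> eqT f h.
Proof. by apply: circle_ae_mono2 => t -> ->. Qed.

Lemma Rintegral_ae_eq (u v : R -> R) : measurable_fun I01 u ->
  measurable_fun I01 v -> {ae mu, forall t, 0 <= t <= 1 -> u t = v t} ->
  \int[mu]_(t in I01) u t = \int[mu]_(t in I01) v t.
Proof.
move=> mu_ mv uv; rewrite /Rintegral; congr fine.
apply: ae_eq_integral => //; try exact/measurable_EFinP.
apply: ae_imply uv => t uvt It; rewrite uvt//.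
Qed.

Lemma circle_int_eqT f g : circle_measurable f -> circle_measurable g ->
  eqT f g -> circle_int f = circle_int g.
Proof.
move=> [f1 f2] [g1 g2] fg; congr Complex; apply: Rintegral_ae_eq => //.
- by apply: ae_imply fg => t fgt It; rewrite fgt.
- by apply: ae_imply fg => t fgt It; rewrite fgt.
Qed.

End Circle.

(** * Square-integrable functions *)

Section L2Theory.
Context {R : realType}.
Local Notation mu := (@lebesgue_measure R).
Local Notation I01 := (`[(0 : R), 1]%classic).
Local Notation C := R[i].
Implicit Types f g h : C -> C.

Lemma circle_measurable_cmod_sqr f : circle_measurable f ->
  measurable_fun I01 (fun t => cmod (f (circle_pt t)) ^+ 2).
Proof.
move=> [f1 f2]; under [X in measurable_fun _ X]eq_fun do rewrite cmod_sqr.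
by apply: measurable_funD; exact: measurable_funX.
Qed.

Lemma L2_dominated f (v : R -> R) : circle_measurable f ->
  mu.-integrable I01 (EFin \o v) ->
  (forall t, I01 t -> cmod (f (circle_pt t)) ^+ 2 <= v t) -> L2 f.
Proof.
move=> mf vi fv; split=> //; apply: (integrable_dominated _ vi).
  exact: circle_measurable_cmod_sqr.
by move=> t It; rewrite ger0_norm ?sqr_ge0//; exact: fv.
Qed.

Lemma L2D f g : L2 f -> L2 g -> L2 (fun z => f z + g z).
Proof.
move=> [mf fi] [mg gi].
apply: (L2_dominated (v := fun t => 2 * (cmod (f (circle_pt t)) ^+ 2)
                                    + 2 * (cmod (g (circle_pt t)) ^+ 2))).
- exact: circle_measurableD.
- by apply: integrable_funD; apply: integrable_funZ.
- move=> t _; rewrite !cmod_sqr complex_ReD complex_ImD.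
  set a := complex.Re (f _); set b := complex.Re (g _).
  set c := complex.Im (f _); set d := complex.Im (g _).
  have := sqr_ge0 (a - b); have := sqr_ge0 (c - d); lra.
Qed.

Lemma cmodM (x y : C) : cmod (x * y) = cmod x * cmod y.
Proof. exact: ComplexField.Normc.normcM. Qed.

Lemma cmod_ge0 (x : C) : 0 <= cmod x.
Proof. by case: x => a b; exact: sqrtr_ge0. Qed.

Lemma cmodJ (x : C) : cmod (conjc x) = cmod x.
Proof. by case: x => a b; rewrite /cmod /= sqrrN. Qed.

Lemma cmod_circle_ptX (t : R) (k : int) : cmod (circle_pt t ^ k) = 1.
Proof.
apply/eqP; rewrite -sqrp_eq1 ?cmod_ge0// cmod_sqr.
have : complex.Re (circle_pt t ^ k * conjc (circle_pt t ^ k)) = 1.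
  by rewrite conj_circle_ptX -expfzDr ?circle_pt_neq0// subrr.
by rewrite complex_ReM complex_ReJ complex_ImJ mulrN opprK -!expr2 => ->.
Qed.

(** The bound on [phi] holds only almost everywhere, so the squared moduli are
    compared under the integral sign rather than pointwise. *)
Lemma L2_mul_Linfty (phi f : C -> C) : Linfty phi -> L2 f ->
  L2 (fun z => phi z * f z).
Proof.
move=> [mphi [M phiM]] [mf fi]; split; first exact: circle_measurableM.
have mp : circle_measurable (fun z => phi z * f z) by exact: circle_measurableM.
apply/integrableP; split.
  by apply/measurable_EFinP; exact: (circle_measurable_cmod_sqr mp).
have : mu.-integrable I01
    (EFin \o (fun t => M ^+ 2 * (cmod (f (circle_pt t)) ^+ 2))).
  exact: integrable_funZ.
move=> /integrableP[mv]; apply: le_lt_trans.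
apply: ae_ge0_le_integral => //.
- apply: measurableT_comp => //.
  by apply/measurable_EFinP; exact: (circle_measurable_cmod_sqr mp).
- exact: measurableT_comp.
- apply: ae_imply phiM => t Mt It; rewrite lee_fin.
  have Mt' : cmod (phi (circle_pt t)) <= M.
    by apply: Mt; move: It; rewrite /= in_itv.
  have M0 : 0 <= M by exact: le_trans (cmod_ge0 _) Mt'.
  rewrite (ger0_norm (sqr_ge0 _)) (ger0_norm (mulr_ge0 (sqr_ge0 _) (sqr_ge0 _))).
  by rewrite cmodM exprMn ler_wpM2r ?sqr_ge0// lerXn2r ?nnegrE ?cmod_ge0.
Qed.

Lemma Linfty_bounded f (M : R) : circle_measurable f ->
  (forall t, cmod (f (circle_pt t)) <= M) -> Linfty f.
Proof. by move=> mf fM; split=> //; exists M; exact: circle_ae_all. Qed.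

Lemma Linfty_cst (c : C) : Linfty (fun=> c).
Proof.
by apply: (@Linfty_bounded _ (cmod c)) => //; exact: circle_measurable_cst.
Qed.

Lemma Linfty_expz (k : int) : Linfty (fun z : C => z ^ k).
Proof.
apply: (@Linfty_bounded _ 1); first exact: circle_measurable_expz.
by move=> t; rewrite cmod_circle_ptX.
Qed.

Lemma L2_cst (c : C) : L2 (fun=> c).
Proof.
split; first exact: circle_measurable_cst.
exact: integrable_unit_itv_cst.
Qed.

Lemma eq_L2 f g : (forall t, f (circle_pt t) = g (circle_pt t)) -> L2 f -> L2 g.
Proof.
move=> fg [mf fi]; split; first exact: eq_circle_measurable mf.
by under [X in _.-integrable _ X]eq_fun do rewrite -fg.
Qed.

Lemma Linfty_L2 f : Linfty f -> L2 f.
Proof.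
move=> fb; apply: (@eq_L2 (fun z => f z * 1)) => [t|]; first by rewrite mulr1.
exact: L2_mul_Linfty fb (L2_cst 1).
Qed.

Lemma L2_expz (k : int) : L2 (fun z : C => z ^ k).
Proof. exact/Linfty_L2/Linfty_expz. Qed.

Lemma L2_monomial (j : nat) : L2 (@monomial R j).
Proof. exact: (L2_expz j). Qed.

Lemma L2Z (c : C) f : L2 f -> L2 (fun z => c * f z).
Proof. exact/L2_mul_Linfty/Linfty_cst. Qed.

Lemma L2N f : L2 f -> L2 (fun z => - f z).
Proof.
by move=> /(L2Z (-1)); apply: eq_L2 => t; rewrite mulN1r.
Qed.

Lemma L2B f g : L2 f -> L2 g -> L2 (fun z => f z - g z).
Proof. by move=> Lf Lg; exact: (L2D Lf (L2N Lg)). Qed.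

Lemma L2J f : L2 f -> L2 (fun z => conjc (f z)).
Proof.
move=> [mf fi]; apply: (L2_dominated _ fi); first exact: circle_measurableJ.
by move=> t _; rewrite cmodJ.
Qed.

Lemma L2_sum (T : Type) (r : seq T) (F : T -> C -> C) :
  (forall j, L2 (F j)) -> L2 (fun z => \sum_(j <- r) F j z).
Proof.
move=> LF; elim: r => [|j r IH].
  by apply: eq_L2 (L2_cst 0) => t; rewrite big_nil.
by apply: eq_L2 (L2D (LF j) IH) => t; rewrite big_cons.
Qed.

Lemma L2_lin_comb (T : Type) (r : seq T) (c : T -> C) (F : T -> C -> C) :
  (forall j, L2 (F j)) -> L2 (fun z => \sum_(j <- r) c j * F j z).
Proof. by move=> LF; apply: L2_sum => j; exact: L2Z. Qed.

(** Both parts of [f * g] are at most [|f|^2 + |g|^2] in absolute value. *)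
Lemma L2_mul_integrable f g : L2 f -> L2 g ->
  circle_integrable (fun z => f z * g z).
Proof.
move=> [mf fi] [mg gi].
have [m1 m2] := circle_measurableM mf mg.
have vi : mu.-integrable I01 (EFin \o (fun t =>
    cmod (f (circle_pt t)) ^+ 2 + cmod (g (circle_pt t)) ^+ 2)).
  exact: integrable_funD.
split; apply: (integrable_dominated _ vi) => // t _;
  rewrite !cmod_sqr ?complex_ReM ?complex_ImM;
  set a := complex.Re (f _); set b := complex.Re (g _);
  set c := complex.Im (f _); set d := complex.Im (g _).
- have := sqr_ge0 (a - b); have := sqr_ge0 (a + b).
  have := sqr_ge0 (c - d); have := sqr_ge0 (c + d).
  by rewrite ler_norml => *; apply/andP; split; nra.
- have := sqr_ge0 (a - d); have := sqr_ge0 (a + d).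
  have := sqr_ge0 (b - c); have := sqr_ge0 (b + c).
  by rewrite ler_norml => *; apply/andP; split; nra.
Qed.

Lemma L2_dot_integrable f g : L2 f -> L2 g ->
  circle_integrable (fun z => f z * conjc (g z)).
Proof. by move=> Lf Lg; apply: L2_mul_integrable => //; exact: L2J. Qed.

Lemma dotL2D f g h : L2 f -> L2 g -> L2 h ->
  dotL2 (fun z => f z + g z) h = dotL2 f h + dotL2 g h.
Proof.
move=> Lf Lg Lh; rewrite /dotL2 -circle_intD; try exact: L2_dot_integrable.
by apply: eq_circle_int => t; rewrite mulrDl.
Qed.

Lemma dotL2Z (c : C) f h : L2 f -> L2 h ->
  dotL2 (fun z => c * f z) h = c * dotL2 f h.
Proof.
move=> Lf Lh; rewrite /dotL2 -circle_intZ; last exact: L2_dot_integrable.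
by apply: eq_circle_int => t; rewrite mulrA.
Qed.

Lemma dotL2B f g h : L2 f -> L2 g -> L2 h ->
  dotL2 (fun z => f z - g z) h = dotL2 f h - dotL2 g h.
Proof.
move=> Lf Lg Lh.
rewrite -mulN1r -dotL2Z// -dotL2D//; last exact: L2Z.
by apply: eq_circle_int => t; rewrite mulN1r.
Qed.

Lemma dotL20 h : dotL2 (fun=> 0) h = 0.
Proof.
by apply: eq_complex_parts => /=; under eq_Rintegral do rewrite mul0r;
  rewrite Rintegral_cst// mul0r.
Qed.

Lemma dotL2_lin_comb (T : Type) (r : seq T) (c : T -> C) (F : T -> C -> C) h :
  (forall j, L2 (F j)) -> L2 h ->
  dotL2 (fun z => \sum_(j <- r) c j * F j z) h =
  \sum_(j <- r) c j * dotL2 (F j) h.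
Proof.
move=> LF Lh; elim: r => [|j r IH].
  rewrite big_nil -[RHS](dotL20 h).
  by apply: eq_circle_int => t; rewrite big_nil.
rewrite big_cons -IH -dotL2Z// -dotL2D//; last 2 first.
- exact: L2Z.
- exact: L2_lin_comb.
by apply: eq_circle_int => t; rewrite big_cons.
Qed.

Lemma dotL2J f g : L2 f -> L2 g -> dotL2 g f = conjc (dotL2 f g).
Proof.
move=> Lf Lg; rewrite /dotL2 -circle_intJ; last exact: L2_dot_integrable.
by apply: eq_circle_int => t; rewrite conjcM conjcK mulrC.
Qed.

Lemma dotL2_eqT f g h : L2 f -> L2 g -> L2 h -> eqT f g ->
  dotL2 f h = dotL2 g h.
Proof.
move=> [mf _] [mg _] [mh _] fg; apply: circle_int_eqT.
- exact/circle_measurableM/circle_measurableJ.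
- exact/circle_measurableM/circle_measurableJ.
- by apply: circle_ae_mono fg => t ->.
Qed.

Lemma eq_dotL2 f g h k :
  (forall t, f (circle_pt t) = g (circle_pt t)) ->
  (forall t, h (circle_pt t) = k (circle_pt t)) ->
  dotL2 f h = dotL2 g k.
Proof. by move=> fg hk; apply: eq_circle_int => t; rewrite fg hk. Qed.

Lemma fourier_shift f (k l : int) :
  fourier (fun z => z ^ k * f z) l = fourier f (l - k).
Proof.
apply: eq_circle_int => t.
rewrite !conj_circle_ptX mulrAC mulrC -expfzDr ?circle_pt_neq0//.
by congr (_ * _ ^ _); rewrite opprB addrC.
Qed.

(** * Orthonormality of the characters *)

Lemma circle_ptX (t : R) (k : nat) : circle_pt t ^+ k = circle_pt (k%:R * t).
Proof.
elim: k => [|k IH].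
  by rewrite expr0 mul0r /circle_pt mulr0 cos0 sin0.
rewrite exprS IH /circle_pt.
have -> : 2 * pi * (k.+1%:R * t) = 2 * pi * t + 2 * pi * (k%:R * t) :> R.
  by rewrite -natr1; ring.
by rewrite cosD sinD; apply: eq_complex_parts => /=; ring.
Qed.

(** A periodic antiderivative has equal values at both ends of the period. *)
Lemma Rintegral_FTC (F f : R -> R) : continuous f ->
  (forall x : R, is_derive x 1 F (f x)) -> F 1 = F 0 ->
  \int[mu]_(t in I01) f t = 0.
Proof.
move=> cf dF F10; rewrite /Rintegral (@continuous_FTC2 _ _ F)//.
- by rewrite F10 subee.
- exact: continuous_subspaceT.
- have cF : continuous F.
    by move=> x; apply: differentiable_continuous; apply/derivable1_diffP; case: (dF x).
  split.
  + by move=> x _; case: (dF x).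
  + exact: cvg_at_right_filter (cF _).
  + exact: cvg_at_left_filter (cF _).
- by move=> x _; rewrite derive1E derive_val.
Qed.

Lemma circle_int_nat (k : nat) : (0 < k)%N ->
  circle_int (fun z : C => z ^+ k) = 0.
Proof.
move=> k0; pose w : R := 2 * pi * k%:R.
have w0 : w != 0 by rewrite !mulf_neq0// ?pnatr_eq0 -?lt0n// gt_eqF// pi_gt0.
have kE (t : R) : circle_pt t ^+ k = Complex (cos (w * t)) (sin (w * t)).
  by rewrite circle_ptX /circle_pt mulrA.
have wE : w * 1 = 0 + pi *+ 2 *+ k.
  by rewrite /w -[in RHS]mulr_natr -[in RHS]mulr_natr; ring.
have cw : continuous ( *%R w) by exact: mulrl_continuous.
apply: eq_complex_parts => /=.
- transitivity (\int[mu]_(t in I01) cos (w * t)).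
    by apply: eq_Rintegral => t _; rewrite kE.
  apply: (@Rintegral_FTC (fun t => w^-1 * sin (w * t))).
  + by move=> t; apply: continuous_comp; [exact: cw|exact: continuous_cos].
  + move=> t; apply: is_derive_eq.
    by rewrite /GRing.scale /=; field.
  + by rewrite mulr0 wE periodicn//; exact: sinD2pi.
- transitivity (\int[mu]_(t in I01) sin (w * t)).
    by apply: eq_Rintegral => t _; rewrite kE.
  apply: (@Rintegral_FTC (fun t => - w^-1 * cos (w * t))).
  + by move=> t; apply: continuous_comp; [exact: cw|exact: continuous_sin].
  + move=> t; apply: is_derive_eq.
    by rewrite /GRing.scale /=; field.
  + by rewrite mulr0 wE periodicn//; exact: cosD2pi.
Qed.

Lemma circle_int1 : circle_int (fun=> 1 : C) = 1.
Proof.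
have e : lebesgue_measure I01 = 1%E.
  by rewrite lebesgue_measure_itv /= lte_fin ltr01 oppr0 adde0.
apply: eq_complex_parts => /=; rewrite Rintegral_cst// ?mul0r// mul1r.
exact: (congr1 fine e).
Qed.

Lemma dotL2_expz (k l : int) :
  dotL2 (fun z : C => z ^ k) (fun z => z ^ l) = (k == l)%:R.
Proof.
wlog kl : k l / (l <= k).
  move=> H; have [/H//|/ltW/H e] := leP l k.
  rewrite dotL2J; try exact: L2_expz.
  by rewrite e eq_sym; case: eqP => _; rewrite ?conjc0 ?conjc1.
transitivity (circle_int (fun z : C => z ^ (k - l))).
  apply: eq_circle_int => t.
  by rewrite conj_circle_ptX -expfzDr ?circle_pt_neq0.
have [->|kl'] := eqVneq k l; first by rewrite subrr; exact: circle_int1.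
have : 0 < k - l by rewrite subr_gt0 lt_neqAle eq_sym kl'.
by case: (k - l) => // m m0; exact: circle_int_nat.
Qed.

Lemma fourier_lin_comb (N : nat) (c : 'I_N -> C) (e : 'I_N -> int) (k : int) :
  fourier (fun z => \sum_(j < N) c j * z ^ e j) k =
  \sum_(j < N) c j * (e j == k)%:R.
Proof.
rewrite /fourier (dotL2_lin_comb _ _ (F := fun j z => z ^ e j)).
- by apply: eq_bigr => j _; rewrite dotL2_expz.
- by move=> j; exact: L2_expz.
- exact: L2_expz.
Qed.

(** * The reflection of the circle *)

Lemma flip_preimage_unit_itv : (fun t : R => 1 - t) @^-1` I01 = I01.
Proof.
by apply/seteqP; split => t /=; rewrite !in_itv/= => /andP[? ?];
  apply/andP; split; lra.
Qed.

Lemma continuous_flip : continuous (fun t : R => 1 - t).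
Proof. by move=> t; apply: cvgB; [exact: cvg_cst|exact: cvg_id]. Qed.

Lemma measurable_flip : measurable_fun setT (fun t : R => 1 - t).
Proof. by apply: continuous_measurable_fun; exact: continuous_flip. Qed.

(** Lebesgue measure is determined by its values on half-open intervals; the
    reflection sends such an interval to one of the same length with the other
    endpoint closed. *)
Lemma lebesgue_measure_flip (A : set R) : measurable A ->
  pushforward mu ((fun t => 1 - t) : _ -> measurableTypeR R) A = mu A.
Proof.
move=> mA; have mf : measurable_fun setT
    ((fun t => 1 - t) : measurableTypeR R -> measurableTypeR R).
  exact: measurable_flip.
pose mfi := isMeasurableFun.Build _ _ _ _ _ mf.
pose fm : {mfun measurableTypeR R >-> measurableTypeR R} :=
  HB.pack ((fun t => 1 - t) : measurableTypeR R -> measurableTypeR R) mfi.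
apply/esym/(@lebesgue_measure_unique _ (pushforward mu fm)) => //= _ [[a b]] _ <-.

rewrite /pushforward/=.
have -> : (fun t : R => 1 - t) @^-1` [set` `]a, b]] = [set` `[1 - b, 1 - a[].
  by apply/seteqP; split => t /=; rewrite !in_itv/= => /andP[? ?];
    apply/andP; split; lra.
rewrite !lebesgue_measure_itv/= !lte_fin.
have -> : (1 - b < 1 - a) = (a < b) by rewrite ltrD2l ltrN2.
by case: ifP => // _; rewrite -!EFinB; congr EFin; ring.
Qed.

Lemma ge0_integral_flip (v : R -> \bar R) : measurable_fun I01 v ->
  (forall t, (0 <= v t)%E) ->
  (\int[mu]_(t in I01) v (1 - t)%R = \int[mu]_(t in I01) v t)%E.
Proof.
move=> mv v0.
rewrite -[X in (integral _ X _ = _)%E]flip_preimage_unit_itv.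
have mf : measurable_fun setT
    ((fun t => 1 - t) : measurableTypeR R -> measurableTypeR R).
  exact: measurable_flip.
rewrite -(ge0_integral_pushforward mf)//.
by apply: eq_measure_integral => A mA AS; exact: lebesgue_measure_flip.
Qed.

Lemma measurable_fun_flip (u : R -> R) : measurable_fun I01 u ->
  measurable_fun I01 (fun t => u (1 - t)).
Proof.
move=> mu_; apply: (@measurable_comp _ _ _ _ _ _ I01 u I01 (fun t => 1 - t)) => //.
  by move=> _ [t It <-]; rewrite -flip_preimage_unit_itv /= subKr.
by apply: measurable_funTS; exact: measurable_flip.
Qed.

Lemma Rintegral_flip (u : R -> R) : measurable_fun I01 u ->
  \int[mu]_(t in I01) u (1 - t) = \int[mu]_(t in I01) u t.
Proof.
move=> mu_; rewrite /Rintegral integralE [in RHS]integralE.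
have mu' : measurable_fun I01 (EFin \o u) by exact/measurable_EFinP.
congr (fine (_ - _)).
- rewrite -(ge0_integral_flip (measurable_funepos mu')).
    by apply: eq_integral => t _; rewrite !funeposE.
  by move=> t; exact: funepos_ge0.
- rewrite -(ge0_integral_flip (measurable_funeneg mu')).
    by apply: eq_integral => t _; rewrite !funenegE.
  by move=> t; exact: funeneg_ge0.
Qed.

Lemma L2_flipJ f : L2 f -> L2 (flipJ f).
Proof.
move=> [[f1 f2] fi].
have mcf : circle_measurable (fun z => f (conjc z)).
  split.
  - have := measurable_fun_flip f1.
    by under [X in measurable_fun _ X -> _]eq_fun do rewrite circle_pt_flip.
  - have := measurable_fun_flip f2.
    by under [X in measurable_fun _ X -> _]eq_fun do rewrite circle_pt_flip.
have Lc : L2 (fun z => f (conjc z)).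
  split=> //; apply/integrableP; split.
    by apply/measurable_EFinP; exact: (circle_measurable_cmod_sqr mcf).
  have [m2 fi2] := integrableP _ _ _ fi.
  apply: le_lt_trans fi2; rewrite -[leRHS]ge0_integral_flip//.
    by under [leRHS]eq_integral do rewrite circle_pt_flip.
  exact: measurableT_comp.
apply: eq_L2 (L2_mul_Linfty (Linfty_expz (-1)) Lc) => t.
by rewrite /flipJ conj_circle_pt exprN1.
Qed.

(** On the circle [J] turns [z ^ m] into [z ^ (- 1 - m)]: this is what makes the
    entries of a truncated Hankel operator depend on the sum of the indices. *)
Lemma fourier_flipJ f (k : int) : L2 f ->
  fourier (flipJ f) k = fourier f (- 1 - k).
Proof.
move=> Lf.
have [m1 m2] := circle_measurableM Lf.1 (circle_measurable_expz (1 + k)).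
have e t : flipJ f (circle_pt t) * conjc (circle_pt t ^ k) =
    f (circle_pt (1 - t)) * circle_pt (1 - t) ^ (1 + k).
  rewrite /flipJ circle_pt_flip conjc_expz mulrAC mulrC expfzDr//.
  by rewrite conj_circle_pt invr_eq0 circle_pt_neq0.
transitivity (circle_int (fun z => f z * z ^ (1 + k))); last first.
  apply: eq_circle_int => t; rewrite conj_circle_ptX.
  by congr (_ * _ ^ _); ring.
apply: eq_complex_parts => /=.
- rewrite -(Rintegral_flip m1).
  by apply: eq_Rintegral => t _; rewrite e.
- rewrite -(Rintegral_flip m2).
  by apply: eq_Rintegral => t _; rewrite e.
Qed.

End L2Theory.

(** * Polynomial approximation of the sign *)

Section SignIteration.
Context {R : realType}.
Implicit Types x y : R.

(** The cubic with fixed points -1, 0 and 1 that is flat at -1 and 1; its iterates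
    are polynomials bounded by 1 on [-1, 1] and tend to the sign there. *)
Definition sgn_step y : R := (3 * y - y ^+ 3) / 2.

(** With [w] the current iterate, [1 - sgn_step w = (1 - w) * (1 - (w + w^2) / 2)],
    and [w] never falls below its initial value [y], so the distance to 1 shrinks
    at least by the factor [1 - y / 2] at each step. *)
Lemma iter_sgn_step_bounds y k : 0 < y <= 1 ->
  [/\ y <= iter k sgn_step y, iter k sgn_step y <= 1 &
      1 - iter k sgn_step y <= (1 - y / 2) ^+ k].
Proof.
move=> /andP[y0 y1]; elim: k => [|k [h1 h2 h3]] /=.
  by split => //; rewrite expr0; lra.
rewrite exprS; set w := iter k sgn_step y in h1 h2 h3 *.
have w0 : 0 < w by lra.
have e1 : sgn_step w - w = w * (1 - w) * (1 + w) / 2 by rewrite /sgn_step; field.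
have e2 : 1 - sgn_step w = (1 - w) * (1 - (w + w ^+ 2) / 2).
  by rewrite /sgn_step; field.
split.
- suff : 0 <= w * (1 - w) * (1 + w) / 2 by rewrite -e1; lra.
  by rewrite !mulr_ge0//; lra.
- suff : 0 <= (1 - w) * (1 - (w + w ^+ 2) / 2) by rewrite -e2; lra.
  by apply: mulr_ge0; nra.
- rewrite e2 mulrC; apply: ler_pM => //; nra.
Qed.

Lemma sgn_stepN y : sgn_step (- y) = - sgn_step y.
Proof. by rewrite /sgn_step; field. Qed.

Lemma iter_sgn_stepN y k : iter k sgn_step (- y) = - iter k sgn_step y.
Proof. by elim: k => //= k ->; rewrite sgn_stepN. Qed.

Lemma iter_sgn_step_le1 y k : `|y| <= 1 -> `|iter k sgn_step y| <= 1.
Proof.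
have [y0|y0|->] := ltrgt0P y.
- move=> y1; have [|h1 h2 _] := @iter_sgn_step_bounds y k; first by rewrite y0.
  by rewrite ger0_norm//; lra.
- move=> y1; have [|h1 h2 _] := @iter_sgn_step_bounds (- y) k; first lra.
  by move: h1 h2; rewrite iter_sgn_stepN => *; rewrite ltr0_norm//; lra.
- move=> _; elim: k => [|k IH] /=; first by rewrite normr0.
  have -> : iter k sgn_step 0 = 0 :> R.
    by elim: k {IH} => //= k ->; rewrite /sgn_step; field.
  by rewrite /sgn_step expr0n mulr0 subr0 mul0r normr0.
Qed.

Lemma iter_sgn_step_cvg y : `|y| <= 1 ->
  iter k sgn_step y @[k --> \oo] --> Num.sg y.
Proof.
have pos x : 0 < x -> x <= 1 -> iter k sgn_step x @[k --> \oo] --> (1 : R).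
  move=> x0 x1; apply: (@squeeze_cvgr _ _ _ _ (fun k => 1 - (1 - x / 2) ^+ k)
      (fun=> 1)).
  - near=> k; have [|h1 h2 h3] := @iter_sgn_step_bounds x k; first by rewrite x0.
    by rewrite h2 andbT; lra.
  - rewrite -[X in _ --> X](subr0 1); apply: cvgB; first exact: cvg_cst.
    by apply: cvg_expr; rewrite ger0_norm; lra.
  - exact: cvg_cst.
have [y0|y0|->] := ltrgt0P y.
- by move=> y1; rewrite gtr0_sg//; exact: pos.
- move=> y1; rewrite ltr0_sg//.
  have : - iter k sgn_step (- y) @[k --> \oo] --> (- 1 : R).
    by apply: cvgN; apply: pos; lra.
  by under eq_fun do rewrite iter_sgn_stepN opprK.
- move=> _; rewrite sgr0.
  have e k : iter k sgn_step 0 = 0 :> R.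
    by elim: k => //= k ->; rewrite /sgn_step; field.
  by under eq_fun do rewrite e; exact: cvg_cst.
Unshelve. all: by end_near. Qed.

End SignIteration.

(** * Trigonometric polynomials *)

Section TrigPoly.
Context {R : realType}.
Local Notation mu := (@lebesgue_measure R).
Local Notation I01 := (`[(0 : R), 1]%classic).
Local Notation C := R[i].

(** Real trigonometric polynomials, written as a complex polynomial in [z] over a
    single power of [z]; products and sums then come from those of polynomials. *)
Definition trig_poly (g : R -> R) : Prop := exists (P : {poly C}) (m : nat),
  forall t, (g t)%:C%C = P.[circle_pt t] * circle_pt t ^ (- m%:Z).

Lemma trig_poly_cst (c : R) : trig_poly (fun=> c).
Proof. by exists (c%:C%C)%:P, 0%N => t; rewrite hornerC expr0z mulr1. Qed.

Lemma trig_polyD (g h : R -> R) : trig_poly g -> trig_poly h ->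
  trig_poly (fun t => g t + h t).
Proof.
move=> [P [m gE]] [Q [k hE]].
exists (P * 'X^k + Q * 'X^m), (m + k)%N => t.
rewrite rmorphD /= gE hE hornerD !hornerM !hornerXn mulrDl.
have z0 := circle_pt_neq0 t.
rewrite PoszD opprD expfzDr// !mulrA.
congr (_ + _).
- by rewrite -!mulrA; congr (_ * _); rewrite mulrCA (exprnP _ k) -expfzDr// subrr mulr1.
- by rewrite -!mulrA; congr (_ * _); rewrite mulrA (exprnP _ m) -expfzDr// subrr mul1r.
Qed.

Lemma trig_polyM (g h : R -> R) : trig_poly g -> trig_poly h ->
  trig_poly (fun t => g t * h t).
Proof.
move=> [P [m gE]] [Q [k hE]]; exists (P * Q), (m + k)%N => t.
rewrite rmorphM /= gE hE hornerM PoszD opprD expfzDr ?circle_pt_neq0//.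
by rewrite mulrACA.
Qed.

Lemma trig_poly_cos (a : R) : trig_poly (fun t => cos (2 * pi * t - a)).
Proof.
pose w : C := Complex (cos a / 2) (- (sin a / 2)).
exists (w *: 'X^2 + (conjc w)%:P), 1%N => t.
rewrite hornerD hornerZ hornerXn hornerC [RHS]mulrDl exprN1.
rewrite expr2 -!mulrA mulfV ?circle_pt_neq0// mulr1 -conj_circle_pt -conjcM.
rewrite cosB; apply: eq_complex_parts; rewrite ?complex_ReD ?complex_ImD ?complex_ReJ ?complex_ImJ.
  by rewrite complex_ReM /w /= (mulrA 2 pi t); field.
by rewrite /= subrr.
Qed.

Lemma trig_poly_iter (g : R -> R) (k : nat) : trig_poly g ->
  trig_poly (fun t => iter k sgn_step (g t)).
Proof.
move=> gT; elim: k => //= k IH.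
have -> : (fun t => sgn_step (iter k sgn_step (g t))) =
    (fun t => iter k sgn_step (g t) *
       (3 / 2 + - (1 / 2) * (iter k sgn_step (g t) * iter k sgn_step (g t)))).
  by apply/funext => t; rewrite /sgn_step; field.
apply: trig_polyM => //; apply: trig_polyD; first exact: trig_poly_cst.
by apply: trig_polyM; [exact: trig_poly_cst|exact: trig_polyM].
Qed.

(** A trigonometric polynomial [g] is a combination of characters, hence [f * g] has
    integral 0; as [g] is real, this can be read off each part of [f] separately. *)
Lemma trig_poly_orthogonal (f : C -> C) (g : R -> R) : L2 f ->
  (forall k, fourier f k = 0) -> trig_poly g ->
  \int[mu]_(t in I01) (complex.Re (f (circle_pt t)) * g t) = 0 /\
  \int[mu]_(t in I01) (complex.Im (f (circle_pt t)) * g t) = 0.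
Proof.
move=> Lf f0 [P [m gE]].
(* the double conjugate gives the product the form of an inner product *)
have : circle_int (fun z => (\sum_(i < size P) P`_i * z ^ (i%:Z - m%:Z)) *
                            conjc (conjc (f z))) = 0.
  rewrite -/(dotL2 _ (fun z => conjc (f z))).
  rewrite (dotL2_lin_comb _ _ (F := fun (i : 'I_(size P)) z => z ^ (i%:Z - m%:Z))).
  - rewrite big1// => i _.
    transitivity (P`_i * fourier f (- (i%:Z - m%:Z))); last by rewrite f0 mulr0.
    congr (_ * _); apply: eq_circle_int => t.
    by rewrite conjcK mulrC conj_circle_ptX opprK.
  - by move=> i; exact: L2_expz.
  - exact: L2J.
rewrite (@eq_circle_int _ _ (fun z => P.[z] * z ^ (- m%:Z) * f z)); last first.
  move=> t; rewrite conjcK horner_coef; congr (_ * _); rewrite mulr_suml.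
  by apply: eq_bigr => i _; rewrite expfzDr ?circle_pt_neq0// mulrA.
move=> /eqP; rewrite eq_complex /= => /andP[/eqP r0 /eqP i0]; split.
- rewrite -[RHS]r0; apply: eq_Rintegral => t _.
  by rewrite -gE complex_ReM/= mul0r subr0 mulrC.
- rewrite -[RHS]i0; apply: eq_Rintegral => t _.
  by rewrite -gE complex_ImM/= mul0r addr0 mulrC.
Qed.

End TrigPoly.

(** * Uniqueness of Fourier coefficients *)

Section Uniqueness.
Context {R : realType}.
Local Notation mu := (@lebesgue_measure R).
Local Notation I01 := (`[(0 : R), 1]%classic).

(** Also equal to [(cos (2 pi t - pi x) - cos (pi x)) / 2], hence a trigonometric
    polynomial in [t]. For [x] and [t] in (0, 1) its sign is that of [x - t], which
    separates the arc from 0 to [x] from the rest of the circle. *)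
Definition arc_fun (x t : R) : R := sin (pi * t) * sin (pi * (x - t)).

Lemma trig_poly_arc_fun x : trig_poly (arc_fun x).
Proof.
have -> : arc_fun x = (fun t => (1 / 2) * cos (2 * pi * t - pi * x)
                               + - (1 / 2) * cos (pi * x)).
  apply/funext => t.
  have -> : 2 * pi * t - pi * x = pi * t - pi * (x - t) by ring.
  have -> : pi * x = pi * t + pi * (x - t) by ring.
  by rewrite cosB cosD /arc_fun; field.
apply: trig_polyD; last exact: trig_poly_cst.
by apply: trig_polyM; [exact: trig_poly_cst|exact: trig_poly_cos].
Qed.

Lemma arc_fun_le1 x t : `|arc_fun x t| <= 1.
Proof. by rewrite /arc_fun normrM mulr_ile1// sin_max. Qed.

Lemma sin_pi_gt0 (t : R) : 0 < t < 1 -> 0 < sin (pi * t).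
Proof.
move=> /andP[t0 t1]; apply: sin_gt0_pi.
by rewrite mulr_gt0 ?pi_gt0//= gtr_pMr ?pi_gt0.
Qed.

Lemma sg_arc_fun (x t : R) : 0 < x < 1 -> 0 < t < 1 -> t != x ->
  Num.sg (arc_fun x t) = if t <= x then 1 else - 1.
Proof.
move=> x01 t01 tx; rewrite /arc_fun sgrM (gtr0_sg (sin_pi_gt0 t01)) mul1r.
have [le_tx|lt_xt] := leP t x.
  apply/gtr0_sg/sin_pi_gt0.
  have : t < x by rewrite lt_neqAle tx.
  by move: x01 t01 => /andP[? ?] /andP[? ?] ?; apply/andP; split; lra.
apply: ltr0_sg; rewrite -(opprB t x) mulrN sinN oppr_lt0; apply: sin_pi_gt0.
by move: x01 t01 => /andP[? ?] /andP[? ?]; apply/andP; split; lra.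
Qed.

Lemma continuous_arc_fun x : continuous (arc_fun x).
Proof.
move=> t; apply: cvgM; (apply: continuous_comp; last exact: continuous_sin).
- by apply: cvgM; [exact: cvg_cst|exact: cvg_id].
- apply: cvgM; first exact: cvg_cst.
  by apply: cvgB; [exact: cvg_cst|exact: cvg_id].
Qed.

Lemma measurable_iter_arc_fun x k :
  measurable_fun I01 (fun t => iter k sgn_step (arc_fun x t)).
Proof.
elim: k => [|k IH] /=.
  apply: measurable_funTS; apply: continuous_measurable_fun.
  exact: continuous_arc_fun.
rewrite /sgn_step; apply: measurable_funM => //.
apply: measurable_funB; last exact: measurable_funX.
exact: measurable_funM.
Qed.

Context (u : R -> R).
Context (ui : mu.-integrable I01 (EFin \o u)).
Context (u_orth : forall g, trig_poly g -> \int[mu]_(t in I01) (u t * g t) = 0).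

Let mu_u : measurable_fun I01 u.
Proof. by apply/measurable_EFinP; exact: (measurable_int _ ui). Qed.

Let mu_sg x : measurable_fun I01 (fun t => Num.sg (arc_fun x t)).
Proof.
apply: (measurable_fun_cvg (h := fun k t => iter k sgn_step (arc_fun x t))).
- by move=> k; exact: measurable_iter_arc_fun.
- by move=> t _; apply: iter_sgn_step_cvg; exact: arc_fun_le1.
Qed.

(** The iterates of [sgn_step] at [arc_fun x] are trigonometric polynomials, bounded
    by 1, that converge to the sign of [arc_fun x]: dominated convergence applies
    with the dominating function [|u|]. *)
Lemma integral_sgn_arc_fun x :
  mu.-integrable I01 (EFin \o (fun t => u t * Num.sg (arc_fun x t))) /\
  \int[mu]_(t in I01) (u t * Num.sg (arc_fun x t)) = 0.
Proof.
have ni : mu.-integrable I01 (EFin \o (fun t => `|u t|)) by exact: integrable_norm.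
have mk k : measurable_fun I01 (fun t => u t * iter k sgn_step (arc_fun x t)).
  by apply: measurable_funM => //; exact: measurable_iter_arc_fun.
have ms : measurable_fun I01 (fun t => u t * Num.sg (arc_fun x t)).
  exact: measurable_funM.
have [] := @dominated_convergence _ _ _ mu I01 measurable_unit_itv
  (fun k t => (u t * iter k sgn_step (arc_fun x t))%:E)
  (fun t => (u t * Num.sg (arc_fun x t))%:E)
  (EFin \o (fun t => `|u t|)).
- by move=> k; apply/measurable_EFinP; exact: mk.
- by apply/measurable_EFinP; exact: ms.
- apply: aeW => t _; apply: cvg_EFin; first exact: nearW.
  apply: cvgM; first exact: cvg_cst.
  by apply: iter_sgn_step_cvg; exact: arc_fun_le1.
- exact: ni.
- apply: aeW => t k _; rewrite /= lee_fin normrM ler_piMr//.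
  by apply: iter_sgn_step_le1; exact: arc_fun_le1.
move=> si _ cv; split=> //; rewrite /Rintegral.
have e k : (\int[mu]_(t in I01) (u t * iter k sgn_step (arc_fun x t))%:E = 0)%E.
  have := u_orth (trig_poly_iter k (trig_poly_arc_fun x)).
  rewrite /Rintegral => H; rewrite -[LHS]fineK ?H//.
  apply: integrable_fin_num => //.
  apply: (integrable_dominated (mk k) ni) => t _; rewrite normrM ler_piMr//.
  by apply: iter_sgn_step_le1; exact: arc_fun_le1.
move: cv; under eq_fun do rewrite e.
by move=> /cvg_lim <-//; rewrite lim_cst.
Qed.

Lemma ae_neq3 (a b c : R) : {ae mu, forall t, [/\ t != a, t != b & t != c]}.
Proof.
exists [set a; b; c]; split.
- by apply: measurableU; [apply: measurableU|]; exact: measurable_set1.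
- by apply: countable_lebesgue_measure0; apply: finite_set_countable.
- move=> t /= H; apply: contrapT => /not_orP[/not_orP[ta tb] tc].
  by apply: H; split; apply/eqP.
Qed.

(** Almost everywhere on [0, 1], the indicator of [t <= x] is half of 1 plus the sign
    of [arc_fun x t]. *)
Lemma integral_initial_segment x :
  \int[mu]_(t in I01) ((u \_ `]-oo, x]) t) = 0.
Proof.
have u0 : \int[mu]_(t in I01) u t = 0.
  rewrite -[RHS](u_orth (trig_poly_cst 1)).
  by apply: eq_Rintegral => t _; rewrite mulr1.
have mr : measurable_fun I01 (u \_ `]-oo, x]).
  apply/measurable_restrict => //; apply: measurable_funS mu_u => //.
have rE t : (u \_ `]-oo, x]) t = if t <= x then u t else 0.
  by rewrite patchE mem_setE in_itv.
have [x0|x0] := leP x 0.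
  rewrite (@Rintegral_ae_eq _ _ (fun=> 0))//; first by rewrite Rintegral_cst// mul0r.
  apply: ae_imply (ae_neq3 0 0 0) => t [t0 _ _] /andP[t0' _].
  by rewrite rE leNgt (le_lt_trans x0)// lt_neqAle eq_sym t0.
have [x1|x1] := leP 1 x.
  rewrite -[RHS]u0; apply: eq_Rintegral => t; rewrite inE /= in_itv/= => /andP[_ t1].
  by rewrite rE (le_trans t1).
have [si s0] := integral_sgn_arc_fun x.
transitivity (\int[mu]_(t in I01) (2^-1 * (u t + u t * Num.sg (arc_fun x t)))).
  apply: Rintegral_ae_eq => //.
    apply: measurable_funM => //; apply: measurable_funD => //.
    exact: measurable_funM.
  apply: ae_imply (ae_neq3 0 1 x) => t [t0 t1 tx] /andP[t0' t1'].
  rewrite rE sg_arc_fun ?x0 ?x1//; last by rewrite !lt_neqAle eq_sym t0 t1 t0'.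
  by case: ifP => _; field.
by rewrite RintegralZl ?RintegralD ?u0 ?s0 ?addr0 ?mulr0//; exact: integrable_funD.
Qed.

(** The indefinite integral of [u] vanishes identically, and by Lebesgue
    differentiation its derivative is [u] almost everywhere. *)
Lemma trig_orthogonal_ae0 : {ae mu, forall t, 0 <= t <= 1 -> u t = 0}.
Proof.
have gi : mu.-integrable setT (EFin \o (u \_ I01)).
  have [h _] := @integrable_mkcond _ _ _ mu I01 (EFin \o u) measurable_unit_itv.
  by rewrite -restrict_EFin; exact: h.
have F0 : (fun x => \int[mu]_(t in `]-oo, x]) (u \_ I01) t) = cst 0.
  apply/funext => x; rewrite -Rintegral_mkcondr setIC Rintegral_mkcondr.
  exact: integral_initial_segment.
have lu : locally_integrable setT (u \_ I01).
  exact: open_integrable_locally openT gi.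
have := @FTC1Ny R (u \_ I01) _ lu.
rewrite F0 /= => FTC.
have gy y : mu.-integrable `]-oo, y] (EFin \o (u \_ I01)).
  exact: integrableS gi.
apply: ae_imply (FTC gy) => t [_]; rewrite derive1_cst => e t01.
by move: e; rewrite patchE mem_setE in_itv /= t01.
Qed.

End Uniqueness.

(** Both parts of [f] are integrable and orthogonal to all real trigonometric
    polynomials. *)
Lemma L2_fourier_uniqueness {R : realType} (f : R[i] -> R[i]) : L2 f ->
  (forall k, fourier f k = 0) -> eqT f (fun=> 0).
Proof.
move=> Lf f0.
have [ri ii] : circle_integrable f.
  have [r i] := L2_mul_integrable Lf (L2_cst 1); split.
    by move: r; under [X in _ \o X]eq_fun do rewrite mulr1.
  by move: i; under [X in _ \o X]eq_fun do rewrite mulr1.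
have [r0 i0] : {ae @lebesgue_measure R, forall t, 0 <= t <= 1 ->
    complex.Re (f (circle_pt t)) = 0} /\ {ae @lebesgue_measure R, forall t, 0 <= t <= 1 ->
    complex.Im (f (circle_pt t)) = 0}.
  split; apply: trig_orthogonal_ae0 => // g gT;
    by have [] := trig_poly_orthogonal Lf f0 gT.
apply: ae_imply2 r0 i0 => t r0 i0 It.
by apply: eq_complex_parts; [exact: r0|exact: i0].
Qed.

(** * The discrete wave equation *)

Section WaveEquation.
Context {V : zmodType}.
Implicit Types (M : nat -> nat -> V) (n : nat).

Definition Toeplitz_plus_Hankel_entries n M : Prop :=
  exists a b : nat -> V, forall i j, (i < n)%N -> (j < n)%N ->
    M i j = a (i + n.-1 - j)%N + b (i + j)%N.

Definition wave_equation n M : Prop :=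
  forall i j : nat, (1 <= i <= n - 2)%N -> (1 <= j <= n - 2)%N ->
    M (i - 1)%N j + M (i + 1)%N j = M i (j - 1)%N + M i (j + 1)%N.

(** The solution of [a (m + 2) - a m = d m] with [a 0 = a 1 = 0]. *)
Fixpoint two_step_sum (d : nat -> V) (m : nat) : V :=
  if m is m'.+2 then two_step_sum d m' + d m' else 0.

(** The Toeplitz part contributes its values at [i - j - 1] and [i - j + 1] to either
    side, the Hankel part those at [i + j - 1] and [i + j + 1]. *)
Lemma Toeplitz_plus_Hankel_wave n M :
  Toeplitz_plus_Hankel_entries n M -> wave_equation n M.
Proof.
move=> [a [b Mab]] i j hi hj.
rewrite !Mab; try lia.
have -> : (i - 1 + n.-1 - j = i + n.-1 - (j + 1))%N by lia.
have -> : (i + 1 + n.-1 - j = i + n.-1 - (j - 1))%N by lia.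
have -> : (i - 1 + j = i + (j - 1))%N by lia.
have -> : (i + 1 + j = i + (j + 1))%N by lia.
by rewrite addrACA [X in X + _]addrC addrACA.
Qed.

(** The wave equation says that [d i j = M (i + 1) j - M i (j + 1)] is constant along
    diagonals. Choosing a Toeplitz array with the same differences, by summing [d] in
    steps of two, leaves a remainder that is constant along antidiagonals. *)
Lemma wave_Toeplitz_plus_Hankel n M : (2 <= n)%N ->
  wave_equation n M -> Toeplitz_plus_Hankel_entries n M.
Proof.
case: n => [|[|p]]// _ wave.
pose d i j := M i.+1 j - M i j.+1.
have d_diag i j : (i.+1 <= p)%N -> (j.+1 <= p)%N -> d i.+1 j.+1 = d i j.
  move=> hi hj; have := wave i.+1 j.+1.
  rewrite !subSS !subn0 !addn1 => /(_ _ _) H.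
  have {}H : M i j.+1 + M i.+2 j.+1 = M i.+1 j + M i.+1 j.+2 by apply: H; lia.
  by apply/eqP; rewrite /d subr_eq addrAC eq_sym subr_eq -H addrC.
(* one of the two truncated differences is 0: the representative of the diagonal
   [i - j = m - p] on the border of the array *)
pose d' m := d (m - p)%N (p - m)%N.
have dE i j : (i <= p)%N -> (j <= p)%N -> d i j = d' (i + p - j)%N.
  elim: i j => [|i IH] [|j] hi hj; rewrite /d'.
  - by congr d; lia.
  - by congr d; lia.
  - by congr d; lia.
  - rewrite d_diag//.
    by rewrite IH; try lia; rewrite /d'; congr d; lia.
pose a := two_step_sum d'.
pose N i j := M i j - a (i + p.+1 - j)%N.
have N_anti i j : (i <= p)%N -> (j <= p)%N -> N i.+1 j = N i j.+1.
  move=> hi hj; rewrite /N.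
  have -> : (i.+1 + p.+1 - j = (i + p - j).+2)%N by lia.
  have -> : (i + p.+1 - j.+1 = i + p - j)%N by lia.
  rewrite /a /= -dE// /d opprD addrA addrAC opprB addrCA subrr addr0.
  by [].
(* the entry of antidiagonal [s] with the largest row index *)
exists a, (fun s => N (minn s p.+1) (s - p.+1)%N) => i j /= hi hj.
have <- : N i j = N (minn (i + j) p.+1) (i + j - p.+1)%N.
  elim: j i hj hi => [|j IH] i hj hi; first by congr N; lia.
  have [->|ip] := eqVneq i p.+1; first by congr N; lia.
  by rewrite -N_anti; try lia; rewrite IH; try lia; congr N; lia.
by rewrite /N addrC subrK.
Qed.

Lemma Toeplitz_plus_Hankel_mxP n (M : nat -> nat -> V) : (0 < n)%N ->
  Toeplitz_plus_Hankel_entries n M <->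
  exists A B : 'M[V]_n, [/\ Toeplitz_mx A, Hankel_mx B &
    \matrix_(i < n, j < n) M i j = A + B].
Proof.
case: n => // p _; split => [[a [b Mab]]|[A [B [TA HB MAB]]]].
  exists (\matrix_(i, j) a (i + p - j)%N), (\matrix_(i, j) b (i + j)%N); split.
  - move=> i j k l e; rewrite !mxE; congr a.
    by have := ltn_ord i; have := ltn_ord j; have := ltn_ord k;
      have := ltn_ord l; lia.
  - by move=> i j k l e; rewrite !mxE e.
  - by apply/matrixP => i j; rewrite !mxE Mab.
(* one entry is chosen on each diagonal and on each antidiagonal *)
exists (fun m => A (inord (m - p)) (inord (p - m))),
  (fun s => B (inord (minn s p)) (inord (s - p))) => i j hi hj /=.
have := congr1 (fun X => fun_of_matrix X (Ordinal hi) (Ordinal hj)) MAB.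
rewrite !mxE /= => ->; congr (_ + _).
- by apply: TA; rewrite !inordK /=; lia.
- by apply: HB; rewrite !inordK /=; lia.
Qed.

End WaveEquation.

(** * The model space of a monomial and its operators *)

Section ModelSpace.
Context {R : realType}.
Local Notation C := R[i].
Implicit Types f g h : C -> C.

Lemma fourier_eqT f g (k : int) : L2 f -> L2 g -> eqT f g ->
  fourier f k = fourier g k.
Proof. by move=> Lf Lg; apply: dotL2_eqT => //; exact: L2_expz. Qed.

Lemma fourierB f g (k : int) : L2 f -> L2 g ->
  fourier (fun z => f z - g z) k = fourier f k - fourier g k.
Proof. by move=> Lf Lg; apply: dotL2B => //; exact: L2_expz. Qed.

Lemma sum_delta (N : nat) (c : 'I_N -> C) (e : 'I_N -> int) (i : 'I_N) :
  injective e -> \sum_(j < N) c j * (e j == e i)%:R = c i.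
Proof.
move=> einj; rewrite (bigD1 i)//= eqxx mulr1 big1 ?addr0// => j ji.
by rewrite (inj_eq einj) (negbTE ji) mulr0.
Qed.

Lemma fourier_lin_comb_at (N : nat) (c : 'I_N -> C) (e : 'I_N -> int)
    (i : 'I_N) : injective e ->
  fourier (fun z => \sum_(j < N) c j * z ^ e j) (e i) = c i.
Proof. by move=> einj; rewrite fourier_lin_comb sum_delta. Qed.

Lemma fourier_lin_comb_out (N : nat) (c : 'I_N -> C) (e : 'I_N -> int)
    (k : int) : (forall j, e j != k) ->
  fourier (fun z => \sum_(j < N) c j * z ^ e j) k = 0.
Proof.
move=> ek; rewrite fourier_lin_comb big1// => j _.
by rewrite (negbTE (ek j)) mulr0.
Qed.

Lemma L2_trig (N : nat) (c : 'I_N -> C) (e : 'I_N -> int) :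
  L2 (fun z => \sum_(j < N) c j * z ^ e j).
Proof. by apply: (L2_lin_comb _ _ (F := fun j z => z ^ e j)) => j; exact: L2_expz. Qed.

Lemma LinftyD f g : Linfty f -> Linfty g -> Linfty (fun z => f z + g z).
Proof.
move=> [mf [M fM]] [mg [N gN]]; split; first exact: circle_measurableD.
exists (M + N); apply: circle_ae_mono2 fM gN => t fM gN.
by apply: le_trans (le_normcD _ _) _; exact: lerD.
Qed.

Lemma LinftyM f g : Linfty f -> Linfty g -> Linfty (fun z => f z * g z).
Proof.
move=> [mf [M fM]] [mg [N gN]]; split; first exact: circle_measurableM.
exists (M * N); apply: circle_ae_mono2 fM gN => t fM gN.
by rewrite cmodM; apply: ler_pM => //; exact: cmod_ge0.
Qed.

Lemma Linfty_trig (N : nat) (c : 'I_N -> C) (e : 'I_N -> int) :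
  Linfty (fun z => \sum_(j < N) c j * z ^ e j).
Proof.
elim: (index_enum 'I_N) => [|j r IH].
  under eq_fun do rewrite big_nil; exact: Linfty_cst.
under eq_fun do rewrite big_cons.
apply: LinftyD => //; apply: LinftyM; first exact: Linfty_cst.
exact: Linfty_expz.
Qed.

Lemma H2_monomial (j : nat) : H2 (@monomial R j).
Proof.
split; first exact: L2_monomial.
by case=> // k _; rewrite /fourier (dotL2_expz j).
Qed.

Lemma dotL2_eq0_sym f g : L2 f -> L2 g -> dotL2 f g = 0 -> dotL2 g f = 0.
Proof. by move=> Lf Lg e; rewrite (dotL2J Lf Lg) e conjc0. Qed.

Context (n : nat).
Local Notation theta := (fun z : C => z ^+ n).
Local Notation K := (model_space theta).

Lemma inner_theta : inner_function theta.
Proof.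
split; first exact: H2_monomial.
by apply: circle_ae_all => t; exact: (cmod_circle_ptX t n).
Qed.

Lemma model_space_L2 f : K f -> L2 f. Proof. by case=> [[]]. Qed.

(** For [k >= n], the character [z ^ k] is [theta] times a monomial. *)
Lemma model_space_fourier0 f (k : int) : K f -> ~~ (0 <= k < n%:Z) ->
  fourier f k = 0.
Proof.
move=> [[Lf f0] fth]; have [k0 _|k0 /=] := ltP k 0; first exact: f0.
rewrite -leNgt => nk.
have [m ->] : exists m : nat, k = (n + m)%N by exists (absz (k - n%:Z)); lia.
rewrite -[RHS](fth (fun z => z ^+ n * monomial m z)); last first.
  by exists (monomial m) => //; exact: H2_monomial.
by apply: eq_dotL2 => t //; rewrite /monomial -exprD.
Qed.

(** Subtracting the finite Fourier sum leaves a function without Fourier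
    coefficients, which is zero by uniqueness. *)
Lemma model_space_expand f : L2 f ->
  (forall k : int, ~~ (0 <= k < n%:Z) -> fourier f k = 0) ->
  eqT f (fun z => \sum_(j < n) fourier f j * monomial j z).
Proof.
move=> Lf f0.
have Ls : L2 (fun z => \sum_(j < n) fourier f j * monomial j z).
  exact: (L2_trig _ (fun j : 'I_n => Posz j)).
suff : eqT (fun z => f z - \sum_(j < n) fourier f j * monomial j z) (fun=> 0).
  by apply: circle_ae_mono => t /eqP; rewrite subr_eq0 => /eqP.
apply: L2_fourier_uniqueness; first exact: L2B.
move=> k; rewrite fourierB//.
have [|kn] := boolP (0 <= k < n%:Z).
  case: k => // k /= kn.
  rewrite (@fourier_lin_comb_at n (fun j => fourier f j) (fun j => Posz j)
    (Ordinal kn)) ?subrr//.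
  by move=> i j [] /val_inj.
rewrite f0// sub0r (fourier_lin_comb_out _ (e := fun j : 'I_n => Posz j)) ?oppr0//.
by move=> j; apply/eqP => jk; move: kn; rewrite -jk; have := ltn_ord j; lia.
Qed.

(** For [h] in [H2] and [j < n], the inner product of [z ^ n * h] with [z ^ j] is the
    Fourier coefficient of [h] at the negative frequency [j - n]. *)
Lemma model_space_of_span f (c : 'I_n -> C) : L2 f ->
  eqT f (fun z => \sum_(j < n) c j * monomial j z) -> K f.
Proof.
move=> Lf fc.
have Ls : L2 (fun z => \sum_(j < n) c j * monomial j z).
  exact: (L2_trig _ (fun j : 'I_n => Posz j)).
split.
  split=> // k k0; rewrite (fourier_eqT _ Lf Ls fc).
  apply: (fourier_lin_comb_out _ (e := fun j : 'I_n => Posz j)) => j.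
  by apply/eqP; lia.
move=> _ [h [Lh h0] <-].
have Lth : L2 (fun z : C => z ^+ n * h z).
  exact: (L2_mul_Linfty (Linfty_expz n) Lh).
rewrite (dotL2_eqT Lf Ls Lth fc) dotL2_lin_comb//; last first.
  by move=> j; exact: L2_monomial.
rewrite big1// => j _; rewrite (dotL2_eq0_sym Lth (L2_monomial j)) ?mulr0//.
rewrite -[LHS]/(fourier _ j%:Z) (fourier_shift h n j) h0//.
by have := ltn_ord j; lia.
Qed.

(** The form in which membership is used below: the model space consists of the
    functions with spectrum in [0, n). *)
Lemma model_spaceP f : K f <->
  L2 f /\ forall k : int, ~~ (0 <= k < n%:Z) -> fourier f k = 0.
Proof.
split=> [Kf|[Lf f0]].
  by split=> [|k]; [exact: model_space_L2|exact: model_space_fourier0].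
exact: (model_space_of_span Lf (model_space_expand Lf f0)).
Qed.

Lemma model_space_eq_span : K = L2span n monomial.
Proof.
apply/seteqP; split=> f.
  move=> /model_spaceP[Lf f0]; split=> //; exists (fun j => fourier f j).
  exact: model_space_expand.
by move=> [Lf [c fc]]; exact: model_space_of_span fc.
Qed.

Lemma monomials_free : L2free n (@monomial R).
Proof.
move=> c c0 j.
have <- := @fourier_lin_comb_at n c (fun j => Posz j) j (fun i k e => val_inj (congr1 absz e)).
rewrite (fourier_eqT _ (L2_trig c (fun j => Posz j)) (L2_cst 0) c0).
exact: dotL20.
Qed.

Lemma model_space_lin_comb (T : Type) (r : seq T) (c : T -> C) (F : T -> C -> C) :
  (forall j, K (F j)) -> K (fun z => \sum_(j <- r) c j * F j z).
Proof.
move=> KF; apply/model_spaceP; split.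
  by apply: L2_lin_comb => j; exact: model_space_L2.
move=> k kn; rewrite /fourier dotL2_lin_comb.
- by rewrite big1// => j _; rewrite -/(fourier _ _) (model_space_fourier0 (KF j) kn) mulr0.
- by move=> j; exact: model_space_L2.
- exact: L2_expz.
Qed.

Lemma model_space_sum (c : 'I_n -> C) :
  K (fun z => \sum_(j < n) c j * monomial j z).
Proof.
apply: (@model_space_of_span _ c); last exact: circle_ae_all.
exact: (L2_trig _ (fun j : 'I_n => Posz j)).
Qed.

Lemma model_space_monomial (j : 'I_n) : K (@monomial R j).
Proof.
apply/model_spaceP; split; first exact: L2_monomial.
move=> k kn; rewrite /fourier (dotL2_expz j).
by case: eqP => // jk; move: kn; rewrite -jk; have := ltn_ord j; lia.
Qed.

Lemma model_space_orthogonal g h : L2 g ->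
  (forall i : 'I_n, fourier g i = 0) -> K h -> dotL2 g h = 0.
Proof.
move=> Lg g0 Kh; have Lh := model_space_L2 Kh.
have Ls := model_space_L2 (model_space_sum (fun j => fourier h j)).
apply: dotL2_eq0_sym => //.
have /model_spaceP[_ h0] := Kh.
rewrite (dotL2_eqT Lh Ls Lg (model_space_expand Lh h0)).
rewrite dotL2_lin_comb//; last by move=> j; exact: L2_monomial.
rewrite big1// => j _; rewrite (dotL2_eq0_sym Lg (L2_monomial j)) ?mulr0//.
exact: g0.
Qed.

Lemma fourier_symbol_mul phi f (k : int) : Linfty phi -> K f ->
  fourier (fun z => phi z * f z) k =
  \sum_(j < n) fourier f j * fourier phi (k - j%:Z).
Proof.
move=> bphi Kf; have /model_spaceP[Lf f0] := Kf.
have Lphi := Linfty_L2 bphi.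
have Lj (j : 'I_n) : L2 (fun z => z ^ j%:Z * phi z).
  exact: (L2_mul_Linfty (Linfty_expz j) Lphi).
transitivity (fourier (fun z => \sum_(j < n) fourier f j * (z ^ j%:Z * phi z)) k).
  apply: fourier_eqT; first exact: L2_mul_Linfty.
    exact: L2_lin_comb.
  apply: circle_ae_mono (model_space_expand Lf f0) => t ->.
  rewrite mulr_sumr; apply: eq_bigr => j _.
  by rewrite mulrC -mulrA.
rewrite /fourier (dotL2_lin_comb _ _ (F := fun (j : 'I_n) z => z ^ j%:Z * phi z))//.
  by apply: eq_bigr => j _; congr (_ * _); exact: fourier_shift.
exact: L2_expz.
Qed.

Context (T : (C -> C) -> (C -> C)) (opT : is_operator K T).

Lemma operator_lin_comb (J : Type) (r : seq J) (c : J -> C) (F : J -> C -> C) :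
  (forall j, K (F j)) ->
  eqT (T (fun z => \sum_(j <- r) c j * F j z))
      (fun z => \sum_(j <- r) c j * T (F j) z).
Proof.
move=> KF; have [TK Teq Tlin] := opT.
elim: r => [|j r IH].
  have K0 : K (fun=> 0).
    have := model_space_lin_comb [::] c KF.
    by congr K; apply/funext => z; rewrite big_nil.
  under [X in T X]eq_fun do rewrite big_nil.
  have := Tlin 1 _ _ K0 K0; under [X in T X]eq_fun do rewrite mulr0 addr0.
  apply: circle_ae_mono => t; rewrite big_nil mul1r => /eqP.
  by rewrite -subr_eq0 opprD addrA subrr sub0r oppr_eq0 => /eqP.
under [X in T X]eq_fun do rewrite big_cons.
apply: eqT_trans (Tlin (c j) _ _ (KF j) (model_space_lin_comb r c KF)) _.
by apply: circle_ae_mono IH => t ->; rewrite big_cons.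
Qed.

Lemma fourier_operator f (i : nat) : K f ->
  fourier (T f) i = \sum_(j < n) fourier f j * entry T i j.
Proof.
move=> Kf; have [TK Teq Tlin] := opT.
have /model_spaceP[Lf f0] := Kf.
have LT j : K (T (monomial (j : 'I_n))) by exact/TK/model_space_monomial.
have Ls : L2 (fun z => \sum_(j < n) fourier f j * T (monomial j) z).
  by apply: L2_lin_comb => j; exact: model_space_L2.
have Tf : eqT (T f) (fun z => \sum_(j < n) fourier f j * T (monomial j) z).
  apply: eqT_trans (Teq _ _ Kf (model_space_sum _) (model_space_expand Lf f0)) _.
  by apply: operator_lin_comb => j; exact: model_space_monomial.
rewrite (fourier_eqT _ (model_space_L2 (TK _ Kf)) Ls Tf) /fourier.
rewrite dotL2_lin_comb//; last exact: L2_expz.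
by move=> j; exact: model_space_L2.
Qed.

(** Projecting onto the model space does not change the inner product with [z ^ i],
    and projecting onto [H2minus] does not change it with a character of negative
    frequency. So the Toeplitz part contributes the coefficient of its symbol at
    [i - j], and the Hankel part that of its symbol at [- 1 - i - j]. *)
Lemma Toeplitz_plus_Hankel_op_entries :
  Toeplitz_plus_Hankel_op theta T -> Toeplitz_plus_Hankel_entries n (entry T).
Proof.
move=> [A [B [[phi bphi HA] [psi bpsi HB] TAB]]].
exists (fun m => fourier phi (m%:Z - n.-1%:Z)), (fun s => fourier psi (- 1 - s%:Z)).
move=> i j hi hj.
have Kj := model_space_monomial (Ordinal hj).
have Ki := model_space_monomial (Ordinal hi).
have Li := L2_monomial (R := R) i; have Lj := L2_monomial (R := R) j.
have [KA Aorth] := HA _ Kj.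
have [g [[Lg _] gorth] [KB Borth]] := HB _ Kj.
have LA := model_space_L2 KA; have LB := model_space_L2 KB.
have mulE (chi : C -> C) (k : int) :
    fourier (fun z => chi z * monomial j z) k = fourier chi (k - j%:Z).
  rewrite -fourier_shift; apply: eq_dotL2 => t //.
  by rewrite mulrC.
have [TK _ _] := opT.
rewrite /entry (dotL2_eqT _ (L2D LA LB) Li (TAB _ Kj)); last first.
  exact/model_space_L2/TK.
rewrite dotL2D//; congr (_ + _).
- have Lp := L2_mul_Linfty bphi Lj.
  have /eqP := Aorth _ Ki; rewrite dotL2B// subr_eq0 => /eqP <-.
  rewrite -[LHS]/(fourier (fun z => phi z * monomial j z) i%:Z) mulE.
  by congr fourier; lia.
- have Lp := L2_mul_Linfty bpsi Lj.
  have LJ := L2_flipJ Lg.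
  have /eqP := Borth _ Ki; rewrite dotL2B// subr_eq0 => /eqP <-.
  rewrite -[LHS]/(fourier _ i%:Z) fourier_flipJ//.
  (* a character of negative frequency, to be tested against [psi * z ^ j - g] *)
  pose m : C -> C := fun z => z ^ (- 1 - i%:Z).
  have Hm : H2minus m.
    split; first exact: L2_expz.
    move=> h [Lh h0]; apply: dotL2_eq0_sym => //; first exact: L2_expz.
    by apply: h0; lia.
  have /eqP := gorth m Hm; rewrite dotL2B//; last exact: L2_expz.
  rewrite subr_eq0 => /eqP e; rewrite /fourier -e.
  rewrite -[LHS]/(fourier (fun z => psi z * monomial j z) (- 1 - i%:Z)) mulE.
  by congr fourier; lia.
Qed.

Lemma Toeplitz_symbol_exists (a : nat -> C) : exists2 phi, Linfty phi &
  forall i j, (i < n)%N -> (j < n)%N ->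
    fourier phi (i%:Z - j%:Z) = a (i + n.-1 - j)%N.
Proof.
(* [n + n] terms cover all the frequencies [i - j], shifted by [n - 1] *)
exists (fun z => \sum_(m < n + n) a m * z ^ (m%:Z - n.-1%:Z)).
  exact: (Linfty_trig _ (fun m : 'I_(n + n) => m%:Z - n.-1%:Z)).
move=> i j hi hj.
have hm : (i + n.-1 - j < n + n)%N by lia.
have -> : i%:Z - j%:Z = (Ordinal hm : nat)%:Z - n.-1%:Z by rewrite /=; lia.
apply: (@fourier_lin_comb_at _ (fun m => a m) (fun m => m%:Z - n.-1%:Z)).
by move=> k l /addIr[] /val_inj.
Qed.

Lemma Hankel_symbol_exists (b : nat -> C) : exists psi, [/\ Linfty psi,
  forall s, (s < n + n)%N -> fourier psi (- 1 - s%:Z) = b s &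
  forall s, (n + n <= s)%N -> fourier psi (- 1 - s%:Z) = 0].
Proof.
exists (fun z => \sum_(m < n + n) b m * z ^ (- 1 - m%:Z)); split.
- exact: (Linfty_trig _ (fun m : 'I_(n + n) => - 1 - m%:Z)).
- move=> s hs.
  apply: (@fourier_lin_comb_at _ (fun m => b m) (fun m => - 1 - m%:Z) (Ordinal hs)).
  by move=> k l /addrI/oppr_inj[] /val_inj.
- move=> s hs.
  apply: (fourier_lin_comb_out _ (e := fun m : 'I_(n + n) => - 1 - m%:Z)) => j.
  by apply/eqP; have := ltn_ord j; lia.
Qed.

Lemma truncated_Toeplitz_of_symbol phi : Linfty phi ->
  truncated_Toeplitz theta (fun f z =>
    \sum_(i < n) fourier (fun w => phi w * f w) i * monomial i z).
Proof.
move=> bphi; exists phi => // f Kf; split; first exact: model_space_sum.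
have Lp := L2_mul_Linfty bphi (model_space_L2 Kf).
have Ls := model_space_L2 (model_space_sum (fun i => fourier (fun w => phi w * f w) i)).
move=> h Kh; apply: model_space_orthogonal Kh; first exact: L2B.
move=> i; rewrite fourierB//.
rewrite (@fourier_lin_comb_at n (fun i => fourier (fun w => phi w * f w) i)
  (fun i => Posz i)) ?subrr//.
by move=> k l [] /val_inj.
Qed.

(** As the symbol has no frequency below [- (n + n)], neither has its product with a
    function in the model space; the projection of this product onto [H2minus] is thus
    a finite sum of characters, which can be written down. *)
Lemma truncated_Hankel_of_symbol psi : Linfty psi ->
  (forall s, (n + n <= s)%N -> fourier psi (- 1 - s%:Z) = 0) ->
  truncated_Hankel theta (fun f z =>
    \sum_(i < n) fourier (fun w => psi w * f w) (- 1 - i%:Z) * monomial i z).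
Proof.
move=> bpsi psi0; exists psi => // f Kf.
have Lp := L2_mul_Linfty bpsi (model_space_L2 Kf).
pose c (m : nat) := fourier (fun w => psi w * f w) (- 1 - m%:Z).
pose g : C -> C := fun z => \sum_(m < n + n) c m * z ^ (- 1 - m%:Z).
have Lg : L2 g by exact: (L2_trig _ (fun m : 'I_(n + n) => - 1 - m%:Z)).
have gE m : (m < n + n)%N -> fourier g (- 1 - m%:Z) = c m.
  move=> hm.
  apply: (@fourier_lin_comb_at _ (fun m => c m) (fun m => - 1 - m%:Z) (Ordinal hm)).
  by move=> k l /addrI/oppr_inj[] /val_inj.
exists g; split.
- split=> // h [Lh h0].
  rewrite (dotL2_lin_comb _ _ (F := fun (m : 'I_(n + n)) z => z ^ (- 1 - m%:Z)))//.
    rewrite big1// => m _; rewrite (@dotL2_eq0_sym h) ?mulr0//; first exact: L2_expz.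
    by apply: h0; lia.
  by move=> m; exact: L2_expz.
- (* the difference has no negative frequency, so it lies in [H2] *)
  move=> h [Lh hH2]; have Ld := L2B Lp Lg.
  apply: dotL2_eq0_sym => //; apply: hH2; split=> // -[//|m] _.
  have -> : Negz m = - 1 - m%:Z by lia.
  rewrite fourierB//.
  have [hm|hm] := ltnP m (n + n); first by rewrite gE// subrr.
  rewrite fourier_symbol_mul// big1; last first.
    move=> j _; rewrite (_ : - 1 - m%:Z - j%:Z = - 1 - (m + j)%N%:Z); last lia.
    by rewrite psi0 ?mulr0//; lia.
  rewrite sub0r (fourier_lin_comb_out _ (e := fun m : 'I_(n + n) => - 1 - m%:Z)) ?oppr0//.
  by move=> j; apply/eqP; have := ltn_ord j; lia.
- exact: model_space_sum.
- have LJ := L2_flipJ Lg.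
  have Ls := model_space_L2 (model_space_sum (fun i => c i)).
  move=> h Kh; apply: model_space_orthogonal Kh; first exact: L2B.
  move=> i; rewrite fourierB// fourier_flipJ// gE; last by have := ltn_ord i; lia.
  rewrite (@fourier_lin_comb_at n (fun i => c i) (fun i => Posz i)) ?subrr//.
  by move=> k l [] /val_inj.
Qed.

(** Take for symbols the trigonometric polynomials with the prescribed coefficients.
    Both sides of the required equality have the same Fourier coefficients, because
    an operator acts on them through its entries. *)
Lemma entries_Toeplitz_plus_Hankel_op :
  Toeplitz_plus_Hankel_entries n (entry T) -> Toeplitz_plus_Hankel_op theta T.
Proof.
move=> [a [b Tab]].
have [phi bphi phiE] := Toeplitz_symbol_exists a.
have [psi [bpsi psiE psi0]] := Hankel_symbol_exists b.
exists (fun f z => \sum_(i < n) fourier (fun w => phi w * f w) i * monomial i z).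
exists (fun f z =>
  \sum_(i < n) fourier (fun w => psi w * f w) (- 1 - i%:Z) * monomial i z).
split; [exact: truncated_Toeplitz_of_symbol|exact: truncated_Hankel_of_symbol|].
move=> f Kf; have [TK _ _] := opT.
have /model_spaceP[LT T0] := TK _ Kf.
apply: circle_ae_mono (model_space_expand LT T0) => t ->.
rewrite -big_split; apply: eq_bigr => i _ /=; rewrite -mulrDl; congr (_ * _).
rewrite fourier_operator// !fourier_symbol_mul// -big_split.
apply: eq_bigr => j _ /=; rewrite -mulrDr; congr (_ * _).
have hi := ltn_ord i; have hj := ltn_ord j.
rewrite Tab// phiE// (_ : - 1 - i%:Z - j%:Z = - 1 - (i + j)%N%:Z); last lia.
by rewrite psiE//; lia.
Qed.

End ModelSpace.

Unset Implicit Arguments.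

Theorem corollary5p10 (R : realType) (n : nat) (hn : (2 <= n)%N) :
  let theta : R[i] -> R[i] := fun z => z ^+ n in
  [/\ inner_function theta,
      model_space theta = L2span n monomial,
      L2free n (@monomial R) &
      forall T : (R[i] -> R[i]) -> (R[i] -> R[i]),
        is_operator (model_space theta) T ->
        (Toeplitz_plus_Hankel_op theta T <->
          forall i j : nat, (1 <= i <= n - 2)%N -> (1 <= j <= n - 2)%N ->
            entry T (i - 1) j + entry T (i + 1) j =
            entry T i (j - 1) + entry T i (j + 1)) /\
        (Toeplitz_plus_Hankel_op theta T <->
          exists A B : 'M[R[i]]_n,
            [/\ Toeplitz_mx A, Hankel_mx B & op_matrix n T = A + B])].
Proof.
move=> theta; split.
- exact: inner_theta.
- exact: model_space_eq_span.
- exact: monomials_free.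
move=> T opT; have n0 : (0 < n)%N by exact: ltnW.
have op_entries : Toeplitz_plus_Hankel_op theta T <->
    Toeplitz_plus_Hankel_entries n (entry T).
  split; first exact: Toeplitz_plus_Hankel_op_entries.
  exact: entries_Toeplitz_plus_Hankel_op.
split.
- rewrite op_entries; split; first exact: Toeplitz_plus_Hankel_wave.
  exact: wave_Toeplitz_plus_Hankel.
- by rewrite op_entries; exact: Toeplitz_plus_Hankel_mxP.
Qed.
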